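(* Let $\{\mathbf{w}^k\}$ and $\{\widetilde{\mathbf{w}}^k\}$ be the sequences generated by GS-ADMM(b) (the case $p=1$, $q\ge1$, $\sigma_1=0$). Then, for any $\sigma_2\in(q-1,+\infty)$ and $(\tau,s)\in\mathcal{K}$, where $$\mathcal{K}=\{(\tau,s)\in\mathbb{R}^2:\ \tau+s>0,\ \tau\le1,\ -\tau^2-s^2-\tau s+\tau+s+1>0\},$$ we have $$\lim_{k\to\infty}\sum_{j=1}^q\|B_j(y_j^k-y_j^{k+1})\|^2=0\quad\text{and}\quad\lim_{k\to\infty}\|Ax^k+\mathcal{B}\mathbf{y}^k-c\|=0,$$ and there exists $\mathbf{w}^\infty\in\mathcal{M}^*$ such that $\lim_{k\to\infty}\widetilde{\mathbf{w}}^k=\mathbf{w}^\infty$.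
   Context: Setting. $q\ge1$ is an integer; $f:\mathbb{R}^{m}\to\mathbb{R}$ and $g_j:\mathbb{R}^{d_j}\to\mathbb{R}$ ($1\le j\le q$) are closed proper convex functions; $A\in\mathbb{R}^{n\times m}$ and $B_j\in\mathbb{R}^{n\times d_j}$ all have full column rank; $c\in\mathbb{R}^n$; $\mathcal{X}\subset\mathbb{R}^{m}$, $\mathcal{Y}_j\subset\mathbb{R}^{d_j}$ are closed convex sets. The problem is: minimize $f(x)+\sum_jg_j(y_j)$ subject to $Ax+\sum_jB_jy_j=c$, $x\in\mathcal{X}$, $y_j\in\mathcal{Y}_j$; its solution set is assumed nonempty. Notation. $\mathcal{B}=(B_1,\dots,B_q)$, $\mathbf{y}=(y_1;\dots;y_q)$, $\mathcal{Y}=\prod_j\mathcal{Y}_j$, $\mathcal{M}=\mathcal{X}\times\mathcal{Y}\times\mathbb{R}^n$, $\mathbf{u}=(x;\mathbf{y})$, $\mathbf{w}=(x;\mathbf{y};\lambda)$, $h(\mathbf{u})=f(x)+\sum_{j=1}^qg_j(y_j)$, $\mathcal{J}(\mathbf{w})=(-A^{\sf T}\lambda;\,-\mathcal{B}^{\sf T}\lambda;\,Ax+\mathcal{B}\mathbf{y}-c)$. For $\beta>0$, $\mathcal{L}_\beta(x,\mathbf{y},\lambda)=h(\mathbf{u})-\langle\lambda,Ax+\mathcal{B}\mathbf{y}-c\rangle+\frac{\beta}{2}\|Ax+\mathcal{B}\mathbf{y}-c\|^2$. $\mathcal{M}^*$ is the set of $\mathbf{w}^*\in\mathcal{M}$ with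 $h(\mathbf{u})-h(\mathbf{u}^* )+\langle\mathbf{w}-\mathbf{w}^*,\mathcal{J}(\mathbf{w}^* )\rangle\ge0$ for all $\mathbf{w}\in\mathcal{M}$. It is assumed that $\mathcal{M}^*\ne\emptyset$. GS-ADMM(b) (parameters $\beta>0,\sigma_2,\tau,s$). From an initial $\mathbf{w}^0=(x^0;\mathbf{y}^0;\lambda^0)\in\mathcal{M}$, for $k=0,1,2,\dots$: (1) $x^{k+1}=\arg\min_{x\in\mathcal{X}}\mathcal{L}_\beta(x,\mathbf{y}^k,\lambda^k)$; (2) $\lambda^{k+\frac12}=\lambda^k-\tau\beta(Ax^{k+1}+\mathcal{B}\mathbf{y}^k-c)$; (3) for each $j$, $y_j^{k+1}=\arg\min_{y_j\in\mathcal{Y}_j}\mathcal{L}_\beta(x^{k+1},y_1^k,\dots,y_j,\dots,y_q^k,\lambda^{k+\frac12})+\frac{\sigma_2\beta}{2}\|B_j(y_j-y_j^k)\|^2$; (4) $\lambda^{k+1}=\lambda^{k+\frac12}-s\beta(Ax^{k+1}+\mathcal{B}\mathbf{y}^{k+1}-c)$. Here $\mathbf{w}^k=(x^k;\mathbf{y}^k;\lambda^k)$, and $\widetilde{\mathbf{w}}^k=(x^{k+1};\mathbf{y}^{k+1};\widetilde\lambda^k)$ with $\widetilde\lambda^k=\lambda^k-\beta(Ax^{k+1}+\mathcal{B}\mathbf{y}^k-c)$. *)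

(* Defs.v *)
From HB Require Import structures.
From mathcomp Require Export all_boot all_order all_algebra.
From mathcomp Require Export all_classical all_reals all_analysis.
Export Order.TTheory GRing.Theory Num.Theory numFieldNormedType.Exports.

#[export] Set Implicit Arguments.
#[export] Unset Strict Implicit.
#[export] Unset Printing Implicit Defensive.

Local Open Scope classical_set_scope.
Local Open Scope ring_scope.

Definition dot {R : realType} {n : nat} (u v : 'cV[R]_n) : R :=
  (u^T *m v) 0 0.

(* The library norm `|v| of a matrix is the sup norm, not the Euclidean one. *)
Definition norm2 {R : realType} {n : nat} (v : 'cV[R]_n) : R :=
  Num.sqrt (dot v v).

Definition argmin {R : realType} {T : Type} (D : set T) (F : T -> R) : set T :=
  [set x | D x /\ forall x', D x' -> F x <= F x'].

Definition proper_function {R : realType} {T : Type} (F : T -> \bar R) : Prop :=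
  (exists x, (F x < +oo)%E) /\ (forall x, (-oo < F x)%E).

(* Closedness of a proper function is lower semicontinuity. *)
Definition closed_proper_convex {R : realType} {n : nat}
    (f : 'cV[R]_n -> R) : Prop :=
  [/\ lower_semicontinuous (EFin \o f), proper_function (EFin \o f)
    & @convex_function R 'cV[R]_n setT f].

Section Problem.
Context {R : realType} {q m n : nat} {d : 'I_q -> nat}.

(* The vector (y_1; ...; y_q) is one column vector y, with y_j the block
   submxcol y j; u and w are the tuples (x, y) and (x, y, lambda). *)
Local Notation yspace := 'cV[R]_(\sum_j d j).
Local Notation uspace := ('cV[R]_m * yspace)%type.
Local Notation wspace := ('cV[R]_m * yspace * 'cV[R]_n)%type.

Definition set_block (y : yspace) (j : 'I_q) (v : 'cV[R]_(d j)) : yspace :=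
  \mxcol_k dfwith (fun i => submxcol y i) j v k.

Definition wdot (w w' : wspace) : R :=
  dot w.1.1 w'.1.1 + dot w.1.2 w'.1.2 + dot w.2 w'.2.

Context (f : 'cV[R]_m -> R) (g : forall j, 'cV[R]_(d j) -> R).
Context (A : 'M[R]_(n, m)) (B : forall j, 'M[R]_(n, d j)) (c : 'cV[R]_n).
Context (X : set 'cV[R]_m) (Y : forall j, set 'cV[R]_(d j)).

Definition calB : 'M[R]_(n, \sum_j d j) := \mxrow_j B j.

Definition calY : set yspace := [set y | forall j, Y (submxcol y j)].

Definition calM : set wspace := (X `*` calY) `*` setT.

Definition obj (u : uspace) : R := f u.1 + \sum_j g (submxcol u.2 j).

Definition residual (u : uspace) : 'cV[R]_n := A *m u.1 + calB *m u.2 - c.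

Definition solutions : set uspace :=
  argmin [set u | [/\ residual u = 0, X u.1 & calY u.2]] obj.

Definition calJ (w : wspace) : wspace :=
  (- (A^T *m w.2), - (calB^T *m w.2), residual w.1).

Definition Mstar : set wspace :=
  [set ws | calM ws /\ forall w, calM w ->
    0 <= obj w.1 - obj ws.1 + wdot (w - ws) (calJ ws)].

Definition aug_lagrangian (beta : R) (w : wspace) : R :=
  obj w.1 - dot w.2 (residual w.1) + beta / 2 * norm2 (residual w.1) ^+ 2.

(* w' is the iterate following w. *)
Definition gs_admm_b_step (beta sigma2 tau s : R) (w w' : wspace) : Prop :=
  let: (x, y, lambda) := w in
  let: (x', y', lambda') := w' in
  let lambda_half := lambda - (tau * beta) *: residual (x', y) in
  [/\ argmin X (fun z => aug_lagrangian beta (z, y, lambda)) x',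
      forall j : 'I_q,
        argmin (@Y j)
          (fun v => aug_lagrangian beta (x', set_block y v, lambda_half)
                    + sigma2 * beta / 2
                      * norm2 (B j *m (v - submxcol y j)) ^+ 2)
          (submxcol y' j)
    & lambda' = lambda_half - (s * beta) *: residual (x', y')].

Definition gs_admm_b (beta sigma2 tau s : R) (w : nat -> wspace) : Prop :=
  calM (w 0%N) /\ forall k, gs_admm_b_step beta sigma2 tau s (w k) (w k.+1).

Definition wtilde (beta : R) (w : nat -> wspace) (k : nat) : wspace :=
  ((w k.+1).1, (w k).2 - beta *: residual ((w k.+1).1.1, (w k).1.2)).

End Problem.

Definition calK {R : realType} : set (R * R) :=
  [set p | let: (tau, s) := p in
    [/\ 0 < tau + s, tau <= 1
      & 0 < - tau ^+ 2 - s ^+ 2 - tau * s + tau + s + 1]].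

(* Main.v *)
Require Import Defs.
From mathcomp Require Import ring lra.
Local Open Scope classical_set_scope.
Local Open Scope ring_scope.

(* Write e_j = B_j (y_j^{k+1} - y_j^k), E = sum_j e_j, p = A x^{k+1} + B y^k - c
   and r' = p + E. The optimality conditions of the subproblems, tested at a
   saddle point, say that the quadratic form
     Phi = (1 + sigma2) sum_j |b_j|^2 - tau |b|^2 + |nu - tau b|^2 / (tau + s)
   of the errors b_j = B_j (y_j - ys_j), b = sum_j b_j, nu = (lambda - ls) / beta
   relative to that saddle point (xs, ys, ls) decreases by at least
     (1 + sigma2) sum_j |e_j|^2 - tau |E|^2 + (2 - tau - s) |r'|^2
       - 2 (1 - tau) <r', E>.
   The only indefinite term, <r', E>, is controlled by testing the y-subproblems
   of two consecutive iterations against each other; with (tau, s) in K, this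
   makes Phi plus multiples of |r|^2 (r the current residual) and of
   N(e) = (1 + sigma2) sum_j |e_j|^2 - |E|^2 strictly decreasing, by at least a
   multiple of |r'|^2 plus N(e). Hence r and e tend to 0 and the iterates are
   bounded; a limit along an ultrafilter is a saddle point, and the merit
   function relative to that point, being monotone and with limit 0 along the
   ultrafilter, tends to 0. *)

(** * Inner products and quadratic forms in the blocks *)

Section InnerProduct.
Context {R : realType} {n : nat}.
Implicit Types (u v w : 'cV[R]_n) (a : R).

Lemma dotE u v : dot u v = \sum_i u i 0 * v i 0.
Proof. by rewrite /dot mxE; apply: eq_bigr => i _; rewrite mxE. Qed.

Lemma dotC u v : dot u v = dot v u.
Proof. by rewrite !dotE; apply: eq_bigr => i _; rewrite mulrC. Qed.

Lemma dotDl u v w : dot (u + v) w = dot u w + dot v w.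
Proof. by rewrite /dot linearD mulmxDl mxE. Qed.

Lemma dotZl a u v : dot (a *: u) v = a * dot u v.
Proof. by rewrite /dot linearZ -scalemxAl mxE. Qed.

Lemma dotDr u v w : dot u (v + w) = dot u v + dot u w.
Proof. by rewrite !(dotC u) dotDl. Qed.

Lemma dotZr a u v : dot u (a *: v) = a * dot u v.
Proof. by rewrite !(dotC u) dotZl. Qed.

Lemma dotNl u v : dot (- u) v = - dot u v.
Proof. by rewrite -scaleN1r dotZl mulN1r. Qed.

Lemma dotNr u v : dot u (- v) = - dot u v.
Proof. by rewrite !(dotC u) dotNl. Qed.

Lemma dot0l v : dot 0 v = 0.
Proof. by rewrite -(scale0r 0) dotZl mul0r. Qed.

Lemma dot0r v : dot v 0 = 0.
Proof. by rewrite dotC dot0l. Qed.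

Lemma dot_suml (I : finType) (e : I -> 'cV[R]_n) v :
  dot (\sum_j e j) v = \sum_j dot (e j) v.
Proof.
exact: (big_morph (fun u => dot u v) (fun u w => dotDl u w v) (dot0l v)).
Qed.

Lemma dot_sumr (I : finType) (e : I -> 'cV[R]_n) v :
  dot v (\sum_j e j) = \sum_j dot v (e j).
Proof. by rewrite dotC dot_suml; apply: eq_bigr => j _; rewrite dotC. Qed.

Lemma dot_ge0 v : 0 <= dot v v.
Proof. by rewrite dotE sumr_ge0 // => i _; rewrite -expr2 sqr_ge0. Qed.

Lemma norm2_sqr v : norm2 v ^+ 2 = dot v v.
Proof. by rewrite sqr_sqrtr // dot_ge0. Qed.

Lemma entry_sqr_le_dot v i : v i 0 ^+ 2 <= dot v v.
Proof.
rewrite dotE (bigD1 i) //= expr2 lerDl sumr_ge0 // => j _.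
by rewrite -expr2 sqr_ge0.
Qed.

End InnerProduct.

Lemma dot_trmx {R : realType} {m n : nat} (M : 'M[R]_(n, m)) u v :
  dot u (M^T *m v) = dot (M *m u) v.
Proof. by rewrite /dot trmx_mul mulmxA. Qed.

Definition dot_linear := (@dotDl, @dotDr, @dotNl, @dotNr, @dotZl, @dotZr).

(** * Quadratic forms on families of block vectors, and the merit function *)

Section BlockForms.
Context {R : realType} {q n : nat}.
Implicit Types (e b : 'I_q -> 'cV[R]_n).

Definition sqsum e : R := \sum_j dot (e j) (e j).

Lemma sqsum_ge0 e : 0 <= sqsum e.
Proof. by rewrite sumr_ge0 // => j _; rewrite dot_ge0. Qed.

Lemma dot_le_sqsum e j : dot (e j) (e j) <= sqsum e.
Proof.
by rewrite /sqsum (bigD1 j) //= lerDl sumr_ge0 // => i _; rewrite dot_ge0.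
Qed.

(** Summing |e_i - e_j|^2 over all pairs gives twice the gap between the two sides. *)
Lemma dot_sum_le e : dot (\sum_j e j) (\sum_j e j) <= q%:R * sqsum e.
Proof.
have : 0 <= \sum_i \sum_j dot (e i - e j) (e i - e j).
  by apply: sumr_ge0 => i _; apply: sumr_ge0 => j _; rewrite dot_ge0.
have -> : \sum_i \sum_j dot (e i - e j) (e i - e j) =
    2 * (q%:R * sqsum e - dot (\sum_j e j) (\sum_j e j)).
  transitivity (\sum_i (q%:R * dot (e i) (e i) + sqsum e
                        - 2 * dot (e i) (\sum_j e j))).
    apply: eq_bigr => i _; rewrite dot_sumr mulr_sumr.
    rewrite -[q in q%:R]card_ord mulr_natl -sumr_const -big_split -sumrB /=.
    by apply: eq_bigr => j _; rewrite !dot_linear (dotC (e j) (e i)); ring.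
  rewrite sumrB big_split /= -mulr_sumr sumr_const card_ord -mulr_sumr.
  by rewrite -dot_suml -/(sqsum e) -mulr_natl; ring.
by rewrite pmulr_rge0 // subr_ge0.
Qed.

Definition blockform sigma e : R :=
  (1 + sigma) * sqsum e - dot (\sum_j e j) (\sum_j e j).

(** By [dot_sum_le]; this is how a sigma above q - 1 makes N positive definite. *)
Lemma blockform_ge sigma e :
  (1 + sigma - q%:R) * sqsum e <= blockform sigma e.
Proof. by rewrite /blockform mulrBl lerD2l lerN2 dot_sum_le. Qed.

Lemma blockform_ge0 sigma e : q%:R - 1 < sigma -> 0 <= blockform sigma e.
Proof.
move=> hs; apply: le_trans (blockform_ge sigma e).
by rewrite mulr_ge0 ?sqsum_ge0 //; lra.
Qed.

Lemma sqsumB e e' :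
  sqsum (fun j => e j - e' j) =
  sqsum e + sqsum e' - 2 * \sum_j dot (e j) (e' j).
Proof.
rewrite /sqsum mulr_sumr -big_split -sumrB /=; apply: eq_bigr => j _.
by rewrite !dot_linear (dotC (e' j) (e j)); ring.
Qed.

(** Convexity of the nonnegative form N: the two sides differ by N(e - e'). *)
Lemma blockform_polar_ge sigma e e' : q%:R - 1 < sigma ->
  blockform sigma e - blockform sigma e' <=
  2 * ((1 + sigma) * (sqsum e - \sum_j dot (e j) (e' j)) -
       dot (\sum_j e j) (\sum_j e j - \sum_j e' j)).
Proof.
move=> hs; rewrite -subr_ge0; have := blockform_ge0 (fun j => e j - e' j) hs.
rewrite /blockform sqsumB sumrB !dot_linear.
rewrite (dotC (\sum_j e' j) (\sum_j e j)) => h; lra.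
Qed.

Definition lyapunov sigma tau s b (nu : 'cV[R]_n) : R :=
  (1 + sigma) * sqsum b
  + (tau + s)^-1 * dot (nu - tau *: \sum_j b j) (nu - tau *: \sum_j b j)
  - tau * dot (\sum_j b j) (\sum_j b j).

(** As tau <= 1, the term -tau |b|^2 is at least -|b|^2, to which [dot_sum_le] applies. *)
Lemma lyapunov_ge sigma tau s b nu : tau <= 1 ->
  (1 + sigma - q%:R) * sqsum b
  + (tau + s)^-1 * dot (nu - tau *: \sum_j b j) (nu - tau *: \sum_j b j)
  <= lyapunov sigma tau s b nu.
Proof.
move=> t1; have := dot_sum_le b; have := dot_ge0 (\sum_j b j).
rewrite /lyapunov; set D := dot (\sum_j b j) _; move=> D0 hD.
have : tau * D <= D by rewrite ler_piMl.
lra.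
Qed.

Lemma lyapunov_decrease sigma tau s b e (nu p : 'cV[R]_n) :
  let E := \sum_j e j in
  0 < tau + s ->
  0 <= dot (p + E) (nu - p) - tau * dot (\sum_j (b j + e j)) p
       - (1 + sigma) * \sum_j dot (b j + e j) (e j) ->
  lyapunov sigma tau s (fun j => b j + e j)
    (nu - (tau + s) *: p - s *: E)
  + ((1 + sigma) * sqsum e - tau * dot E E
     + (2 - tau - s) * dot (p + E) (p + E) - 2 * (1 - tau) * dot (p + E) E)
  <= lyapunov sigma tau s b nu.
Proof.
move=> E ts0; rewrite /lyapunov.
have -> : sqsum (fun j => b j + e j) =
    sqsum b + 2 * \sum_j dot (b j + e j) (e j) - sqsum e.
  rewrite /sqsum mulr_sumr -big_split -sumrB /=; apply: eq_bigr => j _.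
  by rewrite !dot_linear (dotC (e j) (b j)); ring.
rewrite !big_split /= -/E; set F := \sum_j b j.
set S := \sum_j dot (b j + e j) (e j) => h.
(* No slack is lost: the two sides differ by exactly twice the hypothesis [h]. *)
rewrite -subr_ge0; apply: le_trans (mulr_ge0 (ler0n R 2) h) _.
rewrite le_eqVlt; apply/orP; left; apply/eqP.
rewrite !dot_linear (dotC E p) (dotC E nu) (dotC F p) (dotC F nu) (dotC p nu).
rewrite (dotC F E).
by field; rewrite gt_eqF.
Qed.

(** The two weights are the coefficients of |r|^2 and of N in the bound [hXY] on the cross term in
    [merit_decrease], so that these terms telescope. *)
Definition merit sigma tau s b nu (r : 'cV[R]_n) e : R :=
  lyapunov sigma tau s b nu + (1 - s) ^+ 2 / (1 + tau) * dot r r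
  + (1 - tau) / (1 + tau) * blockform sigma e.

Lemma merit_ge sigma tau s b (nu r : 'cV[R]_n) e :
  q%:R - 1 < sigma -> -1 < tau -> tau <= 1 ->
  (1 + sigma - q%:R) * sqsum b
  + (tau + s)^-1 * dot (nu - tau *: \sum_j b j) (nu - tau *: \sum_j b j)
  <= merit sigma tau s b nu r e.
Proof.
move=> hs t0 t1; rewrite /merit; have := lyapunov_ge sigma s b nu t1.
have : 0 <= (1 - s) ^+ 2 / (1 + tau) * dot r r.
  by rewrite mulr_ge0 ?dot_ge0 // divr_ge0 ?sqr_ge0 //; lra.
have : 0 <= (1 - tau) / (1 + tau) * blockform sigma e.
  by rewrite mulr_ge0 ?blockform_ge0 // divr_ge0; lra.
lra.
Qed.

(** The first inequality, supplied by [gap_at_saddle], gives the descent of Phi; the second,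
    supplied by [step_monotone], bounds the cross term <p + E, E> left in it. *)
Lemma merit_decrease sigma tau s b e e0 (nu p r : 'cV[R]_n) :
  let E := \sum_j e j in
  q%:R - 1 < sigma -> 0 < tau + s -> -1 < tau -> tau <= 1 ->
  0 <= dot (p + E) (nu - p) - tau * dot (\sum_j (b j + e j)) p
       - (1 + sigma) * \sum_j dot (b j + e j) (e j) ->
  0 <= dot E ((1 - s) *: r - \sum_j e0 j - (1 + tau) *: p)
       + (1 + sigma) * (\sum_j dot (e j) (e0 j) - sqsum e) ->
  merit sigma tau s (fun j => b j + e j) (nu - (tau + s) *: p - s *: E)
    (p + E) e
  + (blockform sigma e
     + (2 - tau - s - (1 - s) ^+ 2 / (1 + tau)) * dot (p + E) (p + E))
  <= merit sigma tau s b nu r e0.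
Proof.
move=> E hs ts0 t1 t2 /(lyapunov_decrease ts0) + hcross.
have t1' : 0 < 1 + tau by lra.
have := blockform_polar_ge e e0 hs; rewrite -/E.
(* Young's inequality for the cross term <E, r>. *)
have := dot_ge0 ((1 - tau) *: E - (1 - s) *: r).
move: hcross; rewrite /merit -/E; set N := blockform sigma e.
have -> : (1 + sigma) * sqsum e = N + dot E E by rewrite /N /blockform; ring.
set N0 := blockform sigma e0; set L := lyapunov _ _ _ _ _.
set L' := lyapunov _ _ _ _ _; set E0 := \sum_j e0 j; set S := sqsum e.
set rr := dot (p + E) (p + E).
rewrite !dot_linear (dotC r E) (dotC p E).
move=> hcross hY hpolar hdec.
set X := dot E p + dot E E in hdec.
(* [blockform_polar_ge] trades the products of e with e0 for N(e) - N(e0). *)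
have hX : (1 + tau) * X <=
    (1 - s) * dot E r + tau * dot E E - (N - N0) / 2.
  by rewrite /X; lra.
(* Multiply [hX] by 2 (1 - tau) and apply Young. Since 2 tau (1 - tau) + (1 - tau)^2 = (1 - tau) (1
   + tau), the term in |E|^2 is exactly the excess of (1 + sigma) S - tau |E|^2 over N. *)
have hXY : 2 * (1 - tau) * X <= (1 - tau) * dot E E
    + (1 - s) ^+ 2 / (1 + tau) * dot r r - (1 - tau) / (1 + tau) * (N - N0).
  rewrite -(ler_pM2r t1').
  have -> : ((1 - tau) * dot E E + (1 - s) ^+ 2 / (1 + tau) * dot r r
      - (1 - tau) / (1 + tau) * (N - N0)) * (1 + tau) =
      (1 - tau) * (1 + tau) * dot E E + (1 - s) ^+ 2 * dot r r
      - (1 - tau) * (N - N0) by field; rewrite gt_eqF.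
  have : 0 <= 1 - tau by lra.
  move=> /ler_wpM2l /(_ _ _ hX) => {}hX.
  nra.
lra.
Qed.

End BlockForms.

(** The last condition of K reads (1 + tau) (2 - tau - s) > (1 - s)^2; divided by 1 + tau, it makes
    the coefficient of |r'|^2 in [merit_decrease] positive. *)
Lemma calK_bounds {R : realType} (tau s : R) : calK (tau, s) ->
  [/\ 0 < tau + s, -1 < tau, tau <= 1
    & (1 - s) ^+ 2 / (1 + tau) < 2 - tau - s].
Proof.
move=> [ts0 t1 disc].
have t0 : -1 < tau.
  (* Completing the square in s in the last condition of K leaves
     (1 + tau) (5 - 3 tau) > 0. *)
  rewrite ltNge; apply/negP => tN1.
  have := sqr_ge0 (2 * s + tau - 1).
  have : 0 <= (- tau - 1) * (5 - 3 * tau) by apply: mulr_ge0; lra.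
  nra.
by split=> //; rewrite ltr_pdivrMr; nra.
Qed.

(** * Variational inequalities and limits *)

(** F is a convex part phi plus a part exactly quadratic on the segment from x to z, with slope L at
    x. Minimality for small t gives the first-order condition without differentiating phi. *)
Lemma argmin_variational {R : realType} {l : nat} (D : set 'cV[R]_l)
    (phi F : 'cV[R]_l -> R) (x z : 'cV[R]_l) (L C : R) :
  @convex_set R 'cV[R]_l D -> @convex_function R 'cV[R]_l setT phi ->
  argmin D F x -> D z ->
  (forall t v, v = t *: z + (1 - t) *: x ->
     F v - F x = phi v - phi x + t * L + t ^+ 2 * C) ->
  0 <= phi z - phi x + L.
Proof.
move=> Dconv phi_conv [Dx xmin] Dz FE; rewrite leNgt; apply/negP => neg.
set del := phi z - phi x + L in neg.
have C1 : 0 < `|C| + 1 by rewrite ltr_wpDl.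
(* With this t, the term t^2 C offsets at most half of the decrease t * del, so F would be smaller
   at v than at x. *)
pose t := Num.min 1 (- del / (2 * (`|C| + 1))).
have t0 : 0 < t by rewrite lt_min ltr01 divr_gt0 ?oppr_gt0 ?mulr_gt0.
have t1 : t <= 1 by rewrite ge_min lexx.
have tdel : t * (2 * (`|C| + 1)) <= - del.
  by rewrite -ler_pdivlMr ?mulr_gt0 // ge_min lexx orbT.
have t01 : 0 <= t <= 1 by rewrite ltW.
pose ti : {i01 R} := Itv01 (ltW t0) t1.
pose v := t *: z + (1 - t) *: x.
have Dv : D v.
  by apply/set_mem; apply: (Dconv z x ti); rewrite inE.
have phiv : phi v <= t * phi z + (1 - t) * phi x.
  by apply: (phi_conv ti z x); rewrite inE.
have := xmin _ Dv; rewrite -subr_ge0 (FE t v erefl).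
have : t * (t * C) <= t * (- del / 2).
  apply: ler_wpM2l; first exact: ltW.
  have := ler_norm C => /(ler_wpM2l (ltW t0)); nra.
rewrite /del in neg *; rewrite expr2 -mulrA => h1 h2.
have : 0 < t * (- del) by rewrite mulr_gt0 // oppr_gt0.
rewrite /del; nra.
Qed.

(** * Limits along filters *)

Section Limits.
Context {R : realType} {T : Type}.

Lemma cvg_mx {m n : nat} (F : set_system T) {FF : Filter F}
    (v : T -> 'M[R]_(m, n)) (l : 'M[R]_(m, n)) :
  (forall i j, (fun t => v t i j) @ F --> l i j) -> v @ F --> l.
Proof.
move=> vl; apply/cvg_ballP => e e0.
have : \forall t \near F, forall ij : 'I_m * 'I_n,
    ball (l ij.1 ij.2) e (v t ij.1 ij.2).
  by apply: filter_forall => -[i j]; apply: (cvg_ball (vl i j)).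
by apply: filterS => t vt; split=> // i j; exact: (vt (i, j)).
Qed.

Lemma cvg_entry {m n : nat} (F : set_system T) {FF : Filter F}
    (v : T -> 'M[R]_(m, n)) (l : 'M[R]_(m, n)) i j :
  v @ F --> l -> (fun t => v t i j) @ F --> l i j.
Proof.
by move=> vl; apply: (cvg_comp v (fun M => M i j) vl); apply: coord_continuous.
Qed.

Lemma cvg_bigsum {V : normedModType R} (I : finType) (F : set_system T)
    {FF : Filter F} (v : I -> T -> V) (l : I -> V) :
  (forall i, v i @ F --> l i) ->
  (fun t => \sum_i v i t) @ F --> \sum_i l i.
Proof. by move=> vl; apply: cvg_big => //; apply: add_continuous. Qed.

Lemma cvg_mulmx {m n p : nat} (F : set_system T) {FF : Filter F}
    (M : 'M[R]_(m, n)) (v : T -> 'M[R]_(n, p)) l :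
  v @ F --> l -> (fun t => M *m v t) @ F --> M *m l.
Proof.
move=> vl; apply: cvg_mx => i j; rewrite mxE.
under eq_fun do rewrite mxE.
by apply: cvg_bigsum => k; apply: cvgMr; apply: cvg_entry.
Qed.

Lemma cvg_dot {n : nat} (F : set_system T) {FF : Filter F}
    (u v : T -> 'cV[R]_n) l1 l2 :
  u @ F --> l1 -> v @ F --> l2 -> (fun t => dot (u t) (v t)) @ F --> dot l1 l2.
Proof.
move=> ul vl; rewrite dotE; under eq_fun do rewrite dotE.
by apply: cvg_bigsum => k; apply: cvgM; apply: cvg_entry.
Qed.

Lemma dot_cvg0 {n : nat} (F : set_system T) {FF : Filter F} (v : T -> 'cV[R]_n) :
  (fun t => dot (v t) (v t)) @ F --> (0 : R) -> v @ F --> (0 : 'cV[R]_n).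
Proof.
move=> v0; apply: cvg_mx => i j; rewrite mxE ord1; apply/cvgr0Pnorm_lt => e e0.
have e20 : 0 < e ^+ 2 by rewrite exprn_gt0.
move/cvgr0_norm_lt: v0 => /(_ _ e20); apply: filterS => t.
rewrite ger0_norm ?dot_ge0 // => vt.
rewrite -(ltr_pXn2r (_ : 0 < 2)%N) ?nnegrE ?(ltW e0) //.
by rewrite real_normK ?num_real // (le_lt_trans (entry_sqr_le_dot _ i)).
Qed.

(** Replaces the extraction of a convergent subsequence: each entry stays in a compact segment, on
    which every ultrafilter converges. *)
Lemma ultra_bounded_cvg {n : nat} (U : set_system T) {UU : UltraFilter U}
    (v : T -> 'cV[R]_n) (M : R) :
  (forall t, dot (v t) (v t) <= M) ->
  exists l : 'cV[R]_n, v @ U --> l.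
Proof.
move=> vM.
have entryP i : exists l : R, (fun t => v t i 0) @ U --> l.
  (* The bound M + 1 follows from a^2 <= M without a square root. *)
  have := @segment_compact R (- (M + 1)) (M + 1).
  rewrite compact_ultra => /(_ ((fun t => v t i 0) @ U)) [].
  - split; first exact: fmap_proper_filter.
    (* The image of U is maximal: if the preimage of A were not in U, a finer G would contain both A
       and its complement. *)
    move=> G GF UG; apply/seteqP; split=> // A GA.
    have [//|UnA] := in_ultra_setVsetC ((fun t => v t i 0) @^-1` A) UU.
    have GnA : G (~` A) by apply: UG.
    have /filter_ex [x []] : G (A `&` ~` A) by exact: filterI.
    by [].
  - apply: (@filterE _ U) => t /=; rewrite in_itv /= -ler_norml.
    have := le_trans (entry_sqr_le_dot (v t) i) (vM t).
    rewrite -real_normK ?num_real //; have := normr_ge0 (v t i 0).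
    nra.
  - by move=> l [_ ?]; exists l.
have [l lP] := choice entryP.
by exists (\col_i l i); apply: cvg_mx => i j; rewrite ord1 mxE.
Qed.

(** If phi x > b, then near x phi exceeds the midpoint of b and phi x, while a eventually lies below
    it. *)
Lemma lsc_le_cvg {l : nat} (phi : 'cV[R]_l -> R) (F : set_system T)
    {FF : ProperFilter F} (v : T -> 'cV[R]_l) x (a : T -> R) b :
  lower_semicontinuous (EFin \o phi) -> v @ F --> x -> a @ F --> b ->
  (forall t, phi (v t) <= a t) -> phi x <= b.
Proof.
move=> lsc vx ab le_a; rewrite leNgt; apply/negP => bx.
have mid : (((b + phi x) / 2)%:E < (EFin \o phi) x)%E by rewrite lte_fin; lra.
have [V Vx VP] := lsc _ _ mid.
have amid : \forall t \near F, a t < (b + phi x) / 2.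
  by apply: (cvgr_lt b) => //; lra.
have [t [/VP + at_]] := filter_ex (@filterI _ F _ _ _ (vx _ Vx) amid).
by rewrite lte_fin /= => /(lt_trans at_); rewrite ltNge le_a.
Qed.

End Limits.

Lemma cvg_bigsum0 {R : realType} {T : Type} {V : normedModType R} (I : finType)
    (F : set_system T) {FF : Filter F} (v : T -> I -> V) :
  (forall i, v ^~ i @ F --> (0 : V)) ->
  (fun t => \sum_i v t i) @ F --> (0 : V).
Proof.
move=> /(@cvg_bigsum R T V I F FF (fun i t => v t i) (fun=> 0)).
by rewrite (big1 _ _ (fun=> 0)).
Qed.

Lemma cvg0_le {R : realType} {T : Type} (F : set_system T) {FF : Filter F}
    (C : R) (u v : T -> R) :
  (forall t, 0 <= u t) -> (forall t, u t <= C * v t) ->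
  v @ F --> (0 : R) -> u @ F --> (0 : R).
Proof.
move=> u0 uv v0; apply: (squeeze_cvgr (f := fun=> 0) (h := fun t => C * v t)).
- by apply: (@filterE _ F) => t; rewrite u0 uv.
- exact: cvg_cst.
- by rewrite -(mulr0 C); apply: cvgMr.
Qed.

(** v is squeezed under u k - u k.+1, which vanishes because a nonincreasing sequence bounded below
    converges. *)
Lemma decrease_cvg0 {R : realType} (u v : nat -> R) :
  (forall k, 0 <= u k) -> (forall k, 0 <= v k) ->
  (forall k, u k.+1 + v k <= u k) -> v @ \oo --> (0 : R).
Proof.
move=> u0 v0 uv.
have u_cvg : cvgn u.
  apply: nonincreasing_is_cvgn.
    by apply/nonincreasing_seqP => k; have := uv k; have := v0 k; lra.
  by exists 0 => _ [k _ <-].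
apply: (cvg0_le (C := 1) (v := fun k => u k - u k.+1)) => //.
  by move=> k; have := uv k; lra.
rewrite -(subrr (limn u)); apply: cvgB; first exact: u_cvg.
by rewrite cvg_shiftS.
Qed.

(** Smallness along F gives one index with u below e; monotonicity propagates it to all later
    ones. *)
Lemma nonincreasing_cvg0 {R : realType} (u : nat -> R) (F : set_system nat)
    {FF : ProperFilter F} :
  (forall k, 0 <= u k) -> (forall k, u k.+1 <= u k) ->
  u @ F --> (0 : R) -> u @ \oo --> (0 : R).
Proof.
move=> u0 uS uF; apply/cvgr0Pnorm_lt => e e0.
move/cvgr0_norm_lt: uF => /(_ e e0) /filter_ex [k].
rewrite ger0_norm // => uke; exists k => // i /= ki.
rewrite ger0_norm // (le_lt_trans _ uke) //.
by have /nonincreasing_seqP := uS; apply.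
Qed.

Lemma cvg_submxcol {R : realType} {T : Type} {q : nat} {d : 'I_q -> nat}
    (F : set_system T) {FF : Filter F} (v : T -> 'cV[R]_(\sum_j d j))
    (l : 'cV[R]_(\sum_j d j)) :
  v @ F --> l <->
  forall j, (fun t => submxcol (v t) j) @ F --> submxcol l j.
Proof.
split=> [vl j|vl].
  apply: cvg_mx => i k; under eq_fun do rewrite mxE.
  by rewrite mxE; apply: cvg_entry.
apply: cvg_mx => i k; rewrite -(submxcolK l) mxE.
under eq_fun => t do rewrite -(submxcolK (v t)) mxE.
exact: cvg_entry (vl _).
Qed.

Lemma full_column_rank_linv {R : realType} {n m : nat} (M : 'M[R]_(n, m)) :
  \rank M = m -> exists N : 'M[R]_(m, n), N *m M = 1%:M.
Proof. by move=> rk; apply/row_fullP; rewrite /row_full rk. Qed.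

Lemma merit_cvg0 {R : realType} {T : Type} {q n : nat} (F : set_system T)
    {FF : Filter F} sigma tau s (b e : T -> 'I_q -> 'cV[R]_n)
    (nu r : T -> 'cV[R]_n) :
  (forall j, b ^~ j @ F --> (0 : 'cV[R]_n)) -> nu @ F --> (0 : 'cV[R]_n) ->
  r @ F --> (0 : 'cV[R]_n) -> (forall j, e ^~ j @ F --> (0 : 'cV[R]_n)) ->
  (fun t => merit sigma tau s (b t) (nu t) (r t) (e t)) @ F --> (0 : R).
Proof.
move=> b0 nu0 r0 e0.
have add0 (V : normedModType R) (u v : T -> V) : u @ F --> (0 : V) ->
    v @ F --> (0 : V) -> (fun t => u t + v t) @ F --> (0 : V).
  by move=> u0 v0; rewrite -[X in _ --> X]addr0; apply: cvgD.
have scale0 (V : normedModType R) (a : R) (u : T -> V) : u @ F --> (0 : V) ->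
    (fun t => a *: u t) @ F --> (0 : V).
  by move=> u0; rewrite -[X in _ --> X](scaler0 _ a); apply: cvgZr.
have opp0 (V : normedModType R) (u : T -> V) : u @ F --> (0 : V) ->
    (fun t => - u t) @ F --> (0 : V).
  by move=> u0; rewrite -[X in _ --> X]oppr0; apply: cvgN.
have dot0 (u : T -> 'cV[R]_n) : u @ F --> (0 : 'cV[R]_n) ->
    (fun t => dot (u t) (u t)) @ F --> (0 : R).
  by move=> u0; rewrite -(dot0l (0 : 'cV[R]_n)); apply: cvg_dot.
have sqsum0 (u : T -> 'I_q -> 'cV[R]_n) :
    (forall j, u ^~ j @ F --> (0 : 'cV[R]_n)) ->
    (fun t => sqsum (u t)) @ F --> (0 : R).
  by move=> u0; apply: cvg_bigsum0 => j; exact: dot0.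
have sb0 := @cvg_bigsum0 _ _ _ _ F FF _ b0.
have se0 := @cvg_bigsum0 _ _ _ _ F FF _ e0.
have nub0 := add0 _ _ _ nu0 (opp0 _ _ (scale0 _ tau _ sb0)).
apply: (add0 R^o); first apply: (add0 R^o).
- apply: (add0 R^o); last by apply: (opp0 R^o); apply: (scale0 R^o); exact: dot0.
  apply: (add0 R^o); apply: (scale0 R^o); first exact: sqsum0.
  exact: dot0.
- by apply: (scale0 R^o); exact: dot0.
apply: (scale0 R^o); apply: (add0 R^o).
  by apply: (scale0 R^o); exact: sqsum0.
by apply: (opp0 R^o); exact: dot0.
Qed.

(** * The iteration *)

Section Iteration.
Context {R : realType} {q m n : nat} {d : 'I_q -> nat}.
Context (f : 'cV[R]_m -> R) (g : forall j : 'I_q, 'cV[R]_(d j) -> R).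
Context (A : 'M[R]_(n, m)) (B : forall j : 'I_q, 'M[R]_(n, d j)) (c : 'cV[R]_n).
Context (X : set 'cV[R]_m) (Y : forall j : 'I_q, set 'cV[R]_(d j)).

Local Notation yspace := 'cV[R]_(\sum_j d j).
Local Notation wspace := ('cV[R]_m * yspace * 'cV[R]_n)%type.
Local Notation res := (residual A B c).
Local Notation h := (obj f g).

(** * Block decompositions and the saddle-point condition *)

Lemma residualE x (y : yspace) :
  res (x, y) = A *m x + \sum_j B j *m submxcol y j - c.
Proof. by rewrite /residual /= -{1}(submxcolK y) /calB mul_mxrow_mxcol. Qed.

Lemma submxcol_set_block (y : yspace) j (v : 'cV[R]_(d j)) i :
  submxcol (set_block y v) i = dfwith (fun i => submxcol y i) j v i.
Proof. by rewrite /set_block mxcolK. Qed.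

Lemma residual_set_block x (y : yspace) j (v : 'cV[R]_(d j)) :
  res (x, set_block y v) = res (x, y) + B j *m (v - submxcol y j).
Proof.
rewrite !residualE (bigD1 j) //= [in RHS](bigD1 j) //= submxcol_set_block.
rewrite dfwithin mulmxBr (eq_bigr (fun i => B i *m submxcol y i)); last first.
  by move=> i ij; rewrite submxcol_set_block dfwithout // eq_sym.
set S := \sum_(i | _) _; move: (A *m x) (B j *m v) (B j *m _) S => a b b' S.
by apply/colP => i; rewrite !mxE; ring.
Qed.

Lemma obj_set_block x (y : yspace) j (v : 'cV[R]_(d j)) :
  h (x, set_block y v) = h (x, y) + g (v) - g (submxcol y j).
Proof.
rewrite /obj /= (bigD1 j) //= [in RHS](bigD1 j) //= submxcol_set_block dfwithin.
rewrite (eq_bigr (fun i => g (submxcol y i))); last first.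
  by move=> i ij; rewrite submxcol_set_block dfwithout // eq_sym.
by ring.
Qed.

Lemma residualB x x0 (y y0 : yspace) :
  res (x, y) - res (x0, y0) =
  A *m (x - x0) + \sum_j B j *m (submxcol y j - submxcol y0 j).
Proof.
rewrite !residualE mulmxBr.
under [in RHS]eq_bigr do rewrite mulmxBr.
rewrite sumrB; set S := \sum_j _; set S0 := \sum_j _.
move: (A *m x) (A *m x0) S S0 => a a0 S S0.
by apply/colP => i; rewrite !mxE; ring.
Qed.

(** Since lambda ranges over the whole space, the residual must vanish; what remains is the
    minimality of the Lagrangian at ws. *)
Lemma MstarP (ws : wspace) : Mstar f g A B c X Y ws <->
  [/\ X ws.1.1, calY Y ws.1.2, res ws.1 = 0
    & forall x y, X x -> calY Y y ->
        0 <= h (x, y) - h ws.1 - dot ws.2 (res (x, y))].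
Proof.
case: ws => [[x0 y0] l0] /=.
have wdotE x y l : wdot ((x, y, l) - (x0, y0, l0)) (calJ A B c (x0, y0, l0)) =
    - dot l0 (res (x, y) - res (x0, y0)) + dot (l - l0) (res (x0, y0)).
  rewrite /wdot /calJ /=; congr (_ + _).
  rewrite !dotNr !dot_trmx /residual /= -opprD -dotDl dotC !mulmxBr.
  congr (- dot _ _).
  move: (A *m x) (A *m x0) (calB B *m y) (calB B *m y0) => a a0 b b0.
  by apply/colP => i; rewrite !mxE; ring.
split=> [[[[Xx Yy] _] opt]|[Xx Yy r0 opt]].
  have r0 : res (x0, y0) = 0.
    (* Moving only the multiplier, by minus the residual, leaves 0 <= -|res|^2. *)
    have := opt (x0, y0, l0 - res (x0, y0)) (conj (conj Xx Yy) I).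
    rewrite wdotE !subrr dot0r oppr0 !add0r addrAC subrr add0r dotNl oppr_ge0.
    move=> le0; apply/colP => i; rewrite [RHS]mxE; apply/eqP.
    rewrite -sqrf_eq0 eq_le sqr_ge0.
    by rewrite andbT (le_trans (entry_sqr_le_dot _ i)).
  split=> // x y Xx' Yy'; have := opt (x, y, l0) (conj (conj Xx' Yy') I).
  by rewrite wdotE r0 dot0r addr0 subr0.
split=> // -[[x y] l] [[/= Xx' Yy'] _].
by rewrite wdotE r0 dot0r addr0 subr0 opt.
Qed.

(** The block inequalities carry different multipliers l - mu_j; this identity collects them into
    one gap with the common multiplier l, plus corrections. *)
Lemma gap_split x x0 (y y0 : yspace) l (mu : 'I_q -> 'cV[R]_n) :
  f x - f x0 - dot l (A *m (x - x0))
  + \sum_j (g (submxcol y j) - g (submxcol y0 j)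
            - dot (l - mu j) (B j *m (submxcol y j - submxcol y0 j))) =
  h (x, y) - h (x0, y0) - dot l (res (x, y) - res (x0, y0))
  + \sum_j dot (mu j) (B j *m (submxcol y j - submxcol y0 j)).
Proof.
rewrite residualB; pose D j := B j *m (submxcol y j - submxcol y0 j).
have -> : \sum_j B j *m (submxcol y j - submxcol y0 j) = \sum_j D j by [].
rewrite dotDr dot_sumr /obj /= 2!sumrB.
have -> : \sum_j dot (l - mu j) (D j) =
    \sum_j dot l (D j) - \sum_j dot (mu j) (D j).
  by rewrite -sumrB; apply: eq_bigr => j _; rewrite dotDl dotNl.
by ring.
Qed.

(** * Optimality conditions of the subproblems *)

Context (beta sigma tau s : R) (beta_gt0 : 0 < beta).
Context (f_convex : @convex_function R 'cV[R]_m setT f).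
Context (g_convex : forall j, @convex_function R 'cV[R]_(d j) setT (@g j)).
Context (X_convex : @convex_set R 'cV[R]_m X).
Context (Y_convex : forall j, @convex_set R 'cV[R]_(d j) (@Y j)).

(** The derivative of the penalty turns lambda^k into the last component of [wtilde]. *)
Lemma x_step_vi (w w' : wspace) z :
  gs_admm_b_step f g A B c X Y beta sigma tau s w w' -> X z ->
  0 <= f z - f w'.1.1
       - dot (w.2 - beta *: res (w'.1.1, w.1.2)) (A *m (z - w'.1.1)).
Proof.
case: w w' => [[x y] l] [[x' y'] l'] [xmin _ _] Xz /=.
pose D := A *m (z - x').
apply: (argmin_variational (C := beta / 2 * dot D D) X_convex f_convex xmin Xz).
move=> t v vE; rewrite /aug_lagrangian !norm2_sqr /=.
have -> : res (v, y) = res (x', y) + t *: D.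
  apply/eqP; rewrite addrC -subr_eq residualB vE.
  under eq_bigr do rewrite subrr mulmx0.
  rewrite big1 // addr0 /D scalemxAr; apply/eqP; congr (A *m _).
  by apply/colP => i; rewrite !mxE; ring.
rewrite /obj /= -/D; move: (res (x', y)) => r.
by rewrite !dot_linear (dotC D r); field.
Qed.

(** The factor 1 + tau joins the dual half step to the penalty at p; 1 + sigma joins the penalty on
    the block's own move to the proximal term. Only block j moves in its subproblem, hence e_j and
    not E. *)
Lemma y_step_vi (w w' : wspace) j z :
  gs_admm_b_step f g A B c X Y beta sigma tau s w w' -> Y z ->
  0 <= g z - g (submxcol w'.1.2 j)
       - dot (w.2 - beta *: ((1 + tau) *: res (w'.1.1, w.1.2) + (1 + sigma) *:
                (B j *m (submxcol w'.1.2 j - submxcol w.1.2 j))))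
             (B j *m (z - submxcol w'.1.2 j)).
Proof.
case: w w' => [[x y] l] [[x' y'] l'] [_ /(_ j) ymin _] Yz /=.
pose D := B j *m (z - submxcol y' j).
apply: (argmin_variational (C := beta / 2 * (1 + sigma) * dot D D)
  (@Y_convex j) (@g_convex j) ymin Yz).
move=> t v vE; rewrite /aug_lagrangian !norm2_sqr /= !residual_set_block.
have -> : B j *m (v - submxcol y j) =
    B j *m (submxcol y' j - submxcol y j) + t *: D.
  rewrite scalemxAr -mulmxDr vE; congr (B j *m _).
  by apply/colP => i; rewrite !mxE; ring.
rewrite !obj_set_block -/D; move: (res (x', y)) (B j *m _) => r a.
by rewrite !dot_linear (dotC a r) (dotC D r) (dotC D a); field.
Qed.

(** * Errors along the iterates and descent of the merit function *)

Context (w : nat -> wspace).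
Context (w_step : forall k,
  gs_admm_b_step f g A B c X Y beta sigma tau s (w k) (w k.+1)).

(** [block_err], [block_step], [half_residual] and [dual_err] are b_j, e_j, p and nu of the
    overview, with an arbitrary reference point for the errors. *)
Definition block_err (y : yspace) k j : 'cV[R]_n :=
  B j *m (submxcol (w k).1.2 j - submxcol y j).

Definition block_step k j : 'cV[R]_n :=
  B j *m (submxcol (w k.+1).1.2 j - submxcol (w k).1.2 j).

Definition half_residual k : 'cV[R]_n := res ((w k.+1).1.1, (w k).1.2).

Definition dual_err (l : 'cV[R]_n) k : 'cV[R]_n := beta^-1 *: ((w k).2 - l).

Lemma block_err_step (y : yspace) k :
  block_err y k.+1 = (fun j => block_err y k j + block_step k j).
Proof.
apply/funext => j; rewrite /block_err /block_step -mulmxDr; congr (B j *m _).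
by apply/colP => i; rewrite !mxE; ring.
Qed.

Lemma residual_step k :
  res (w k.+1).1 = half_residual k + \sum_j block_step k j.
Proof.
apply/eqP; rewrite addrC -subr_eq [(w k.+1).1]surjective_pairing residualB.
by rewrite subrr mulmx0 add0r.
Qed.

Lemma dual_step k :
  (w k.+1).2 = (w k).2 - (tau * beta) *: half_residual k
               - (s * beta) *: res (w k.+1).1.
Proof.
rewrite /half_residual; have := w_step k.
by case: (w k) (w k.+1) => [[x y] l] [[x' y'] l'] [_ _].
Qed.

Lemma dual_err_step l k : dual_err l k.+1 =
  dual_err l k - (tau + s) *: half_residual k - s *: \sum_j block_step k j.
Proof.
rewrite /dual_err dual_step residual_step.
move: (half_residual k) (\sum_j block_step k j) (w k).2 => p E l0.
by apply/colP => i; rewrite !mxE; field; rewrite gt_eqF.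
Qed.

Lemma iterate_feasible k : X (w k.+1).1.1 /\ calY Y (w k.+1).1.2.
Proof.
have := w_step k.
case: (w k) (w k.+1) => [[x y] l] [[x' y'] l'] [[Xx _] ymin _].
by split=> // j; case: (ymin j).
Qed.

(** [y_step_vi] with its multiplier split as in [gap_split]: the one of the x-step, minus a block
    correction. *)
Lemma block_gap_step k j z : Y z ->
  0 <= g z - g (submxcol (w k.+1).1.2 j)
       - dot ((w k).2 - beta *: half_residual k
              - beta *: (tau *: half_residual k + (1 + sigma) *: block_step k j))
             (B j *m (z - submxcol (w k.+1).1.2 j)).
Proof.
move=> Yz; have := y_step_vi (w_step k) Yz.
rewrite -/(half_residual k) -/(block_step k j).
have -> : (w k).2 - beta *: ((1 + tau) *: half_residual k
      + (1 + sigma) *: block_step k j) =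
    (w k).2 - beta *: half_residual k
      - beta *: (tau *: half_residual k + (1 + sigma) *: block_step k j).
  move: (half_residual k) (block_step k j) (w k).2 => p e l0.
  by apply/colP => i; rewrite !mxE; ring.
by [].
Qed.

Lemma gap_step k x (y : yspace) : X x -> calY Y y ->
  0 <= h (x, y) - h (w k.+1).1
       - dot ((w k).2 - beta *: half_residual k) (res (x, y) - res (w k.+1).1)
       + \sum_j dot (beta *: (tau *: half_residual k
                              + (1 + sigma) *: block_step k j))
                    (B j *m (submxcol y j - submxcol (w k.+1).1.2 j)).
Proof.
move=> Xx Yy; rewrite [(w k.+1).1]surjective_pairing -gap_split.
apply: addr_ge0; first exact: (x_step_vi (w_step k)).
by apply: sumr_ge0 => j _; apply: block_gap_step.
Qed.

(* Both this lemma and step_monotone are stated after division by beta. *)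
Lemma gap_at_saddle ws k : Mstar f g A B c X Y ws ->
  0 <= dot (half_residual k + \sum_j block_step k j)
         (dual_err ws.2 k - half_residual k)
       - tau * dot (\sum_j (block_err ws.1.2 k j + block_step k j))
                   (half_residual k)
       - (1 + sigma) * \sum_j dot (block_err ws.1.2 k j + block_step k j)
                                  (block_step k j).
Proof.
case/MstarP; case: ws => [[xs ys] ls] /= Xs Ys r0 opt.
have [Xx Yy] := iterate_feasible k.
(* Adding the gap tested at the saddle point to the saddle inequality at the new iterate cancels the
   objective values. *)
have := addr_ge0 (gap_step k Xs Ys) (opt _ _ Xx Yy).
rewrite -surjective_pairing r0 sub0r.
have -> : \sum_j dot (beta *: (tau *: half_residual k
      + (1 + sigma) *: block_step k j))
      (B j *m (submxcol ys j - submxcol (w k.+1).1.2 j)) =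
    - beta * (tau * dot (\sum_j block_err ys k.+1 j) (half_residual k)
      + (1 + sigma) * \sum_j dot (block_err ys k.+1 j) (block_step k j)).
  rewrite dot_suml !mulr_sumr -big_split mulr_sumr /=; apply: eq_bigr => j _.
  rewrite -opprB mulmxN -/(block_err ys k.+1 j).
  move: (block_err _ _ _) (block_step k j) (half_residual k) => b e p.
  by rewrite !dot_linear (dotC e b) (dotC p b); ring.
rewrite block_err_step residual_step /dual_err.
move: (\sum_j (_ + _)) (\sum_j dot _ _) (half_residual k) => b S p.
move: (\sum_j _) (w k).2 (h _) (h _) => E l h2 h1.
set G := (X in _ -> 0 <= X).
suff -> : h1 - h2 - dot (l - beta *: p) (- (p + E))
     + - beta * (tau * dot b p + (1 + sigma) * S)
     + (h2 - h1 - dot ls (p + E)) = beta * G by rewrite pmulr_rge0.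
rewrite /G !dot_linear (dotC ls) (dotC ls) (dotC l) (dotC l) (dotC p E).
by field; rewrite gt_eqF.
Qed.

(** Two consecutive y-subproblems are each tested at the solution of the other; the values of g
    cancel in the sum, as in the monotonicity of a subdifferential. *)
Lemma step_monotone k :
  0 <= dot (\sum_j block_step k.+1 j)
         ((1 - s) *: res (w k.+1).1 - \sum_j block_step k j
          - (1 + tau) *: half_residual k.+1)
       + (1 + sigma) * (\sum_j dot (block_step k.+1 j) (block_step k j)
                        - sqsum (block_step k.+1)).
Proof.
set e := block_step k.+1; set e0 := block_step k.
have [_ Y1] := iterate_feasible k.
have [_ Y2] := iterate_feasible k.+1.
pose V := (1 - s) *: res (w k.+1).1 - \sum_j e0 j
          - (1 + tau) *: half_residual k.+1.
rewrite -/V.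
suff -> : dot (\sum_j e j) V + (1 + sigma) * (\sum_j dot (e j) (e0 j) - sqsum e)
    = \sum_j (dot (e j) V + (1 + sigma) * (dot (e j) (e0 j) - dot (e j) (e j))).
  apply: sumr_ge0 => j _; rewrite -(pmulr_rge0 _ beta_gt0).
  have h1 := y_step_vi (w_step k) (Y2 j).
  have h2 := y_step_vi (w_step k.+1) (Y1 j).
  have e_opp : B j *m (submxcol (w k.+1).1.2 j - submxcol (w k.+2).1.2 j) = - e j.
    by rewrite -opprB mulmxN.
  rewrite e_opp in h2; move: (addr_ge0 h1 h2).
  rewrite -/(half_residual k) -/(half_residual k.+1).
  rewrite -/(block_step k j) -/(block_step k.+1 j) -/(e j) -/(e0 j).
  (* Once [dual_step] eliminates lambda^{k+1}, the second multiplier minus the first is beta times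
     this form of V plus beta (1 + sigma) (e0 j - e j). *)
  have -> : V = half_residual k - s *: res (w k.+1).1
      - (1 + tau) *: half_residual k.+1.
    rewrite /V residual_step.
    move: (half_residual k) (half_residual _) (\sum_j _) => p p' E.
    by apply/colP => i; rewrite !mxE; ring.
  rewrite dual_step; congr (0 <= _).
  move: (half_residual k) (half_residual k.+1) (res _) => p p' r.
  move: (e j) (e0 j) => u u0.
  move: (w k).2 (g _) (g _) => l g1 g2.
  rewrite !dot_linear (dotC p) (dotC p') (dotC r) (dotC u0) (dotC l).
  by ring.
rewrite big_split /= -mulr_sumr sumrB -dot_suml.
by [].
Qed.

(** Evaluated at iterate k + 1, because it involves the step leading to that iterate. *)
Definition merit_at (ws : wspace) k : R :=
  merit sigma tau s (block_err ws.1.2 k.+1) (dual_err ws.2 k.+1)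
    (res (w k.+1).1) (block_step k).

Lemma merit_at_decrease ws k : Mstar f g A B c X Y ws ->
  q%:R - 1 < sigma -> calK (tau, s) ->
  merit_at ws k.+1
  + (blockform sigma (block_step k.+1)
     + (2 - tau - s - (1 - s) ^+ 2 / (1 + tau))
       * dot (res (w k.+2).1) (res (w k.+2).1))
  <= merit_at ws k.
Proof.
move=> Mws hs /calK_bounds[ts0 t0 t1 _].
rewrite /merit_at block_err_step dual_err_step (residual_step k.+1).
exact: (merit_decrease hs ts0 t0 t1 (gap_at_saddle k.+1 Mws) (step_monotone k)).
Qed.

Lemma half_residual_cvg0 (F : set_system nat) {FF : Filter F} :
  (fun k => res (w k.+1).1) @ F --> (0 : 'cV[R]_n) ->
  (forall j, block_step ^~ j @ F --> (0 : 'cV[R]_n)) ->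
  half_residual @ F --> (0 : 'cV[R]_n).
Proof.
move=> r0 e0.
have -> : half_residual = fun k => res (w k.+1).1 - \sum_j block_step k j.
  by apply/funext => k; rewrite residual_step addrK.
by rewrite -[X in _ --> X]subr0; apply: cvgB => //; exact: cvg_bigsum0.
Qed.

(** * Limits of the iterates along a filter *)

Context (LA : 'M[R]_(m, n)) (LB : forall j : 'I_q, 'M[R]_(d j, n)).
Context (LA_inv : LA *m A = 1%:M) (LB_inv : forall j, LB j *m B j = 1%:M).

(** Left inverses recover y from its errors, and x from A x = r + c - B y; the predicted multiplier
    differs from lambda^{k+1} by a combination of p and E that vanishes. F is general so as to cover
    both an ultrafilter and the whole sequence. *)
Lemma wtilde_cvg (F : set_system nat) {FF : Filter F} (y0 : yspace)
    (l0 nu : 'cV[R]_n) (b : 'I_q -> 'cV[R]_n) :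
  (fun k => res (w k.+1).1) @ F --> (0 : 'cV[R]_n) ->
  (forall j, block_step ^~ j @ F --> (0 : 'cV[R]_n)) ->
  (forall j, (fun k => block_err y0 k.+1 j) @ F --> b j) ->
  (fun k => dual_err l0 k.+1) @ F --> nu ->
  let y : yspace := y0 + \mxcol_j (LB j *m b j) in
  wtilde A B c beta w @ F --> (LA *m (c - calB B *m y), y, l0 + beta *: nu).
Proof.
move=> r0 e0 bF nuF y.
have yF : (fun k => (w k.+1).1.2) @ F --> y.
  apply/cvg_submxcol => j; rewrite submxcolD mxcolK.
  have -> : (fun k => submxcol (w k.+1).1.2 j) =
      fun k => submxcol y0 j + LB j *m block_err y0 k.+1 j.
    apply/funext => k; rewrite /block_err mulmxA LB_inv mul1mx.
    by rewrite [RHS]addrC subrK.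
  by apply: cvgD; [exact: cvg_cst | exact: cvg_mulmx].
have xF : (fun k => (w k.+1).1.1) @ F --> LA *m (c - calB B *m y).
  have -> : (fun k => (w k.+1).1.1) =
      fun k => LA *m (res (w k.+1).1 + (c - calB B *m (w k.+1).1.2)).
    apply/funext => k; rewrite /residual addrA subrK addrK.
    by rewrite mulmxA LA_inv mul1mx.
  apply: cvg_mulmx; rewrite -[c - _ in X in _ --> X]add0r; apply: cvgD => //.
  by apply: cvgB; [exact: cvg_cst | exact: cvg_mulmx].
have lF : (fun k => (w k).2 - beta *: half_residual k) @ F --> l0 + beta *: nu.
  have -> : (fun k => (w k).2 - beta *: half_residual k) = fun k =>
      l0 + beta *: dual_err l0 k.+1 + beta *: ((tau + s - 1) *: half_residual k
        + s *: \sum_j block_step k j).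
    apply/funext => k; rewrite /dual_err dual_step residual_step.
    move: (half_residual k) (\sum_j block_step k j) (w k).2 => p E l.
    by apply/colP => i; rewrite !mxE; field; rewrite gt_eqF.
  have lim : l0 + beta *: nu =
      l0 + beta *: nu + beta *: ((tau + s - 1) *: 0 + s *: 0).
    by rewrite !scaler0 addr0 scaler0 addr0.
  rewrite [X in _ --> X]lim; apply: cvgD.
    by apply: cvgD; [exact: cvg_cst | exact: cvgZr].
  apply: cvgZr; apply: cvgD; apply: cvgZr; last exact: cvg_bigsum0.
  exact: half_residual_cvg0.
have -> : wtilde A B c beta w =
    fun k => ((w k.+1).1.1, (w k.+1).1.2, (w k).2 - beta *: half_residual k).
  by apply/funext => k; rewrite /wtilde -surjective_pairing.
exact: (cvg_pair (cvg_pair xF yF) lF).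
Qed.

(** The variational inequalities of the subproblems pass to the limit, by lower semicontinuity for
    the values at the iterates and by p, e -> 0 for the corrections; [gap_split] with mu = 0
    reassembles them. *)
Lemma cluster_in_Mstar (F : set_system nat) {FF : ProperFilter F} (winf : wspace) :
  lower_semicontinuous (EFin \o f) ->
  (forall j, lower_semicontinuous (EFin \o @g j)) ->
  closed X -> (forall j, closed (@Y j)) ->
  (fun k => res (w k.+1).1) @ F --> (0 : 'cV[R]_n) ->
  (forall j, block_step ^~ j @ F --> (0 : 'cV[R]_n)) ->
  wtilde A B c beta w @ F --> winf -> Mstar f g A B c X Y winf.
Proof.
move=> f_lsc g_lsc X_cl Y_cl r0 e0; case: winf => [[x y] l] wF.
have xF : (fun k => (w k.+1).1.1) @ F --> x.
  by apply: (cvg_comp _ _ (cvg_comp _ _ wF cvg_fst) cvg_fst).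
have yF : (fun k => (w k.+1).1.2) @ F --> y.
  by apply: (cvg_comp _ _ (cvg_comp _ _ wF cvg_fst) cvg_snd).
have lF : (fun k => (w k).2 - beta *: half_residual k) @ F --> l.
  exact: (cvg_comp _ _ wF cvg_snd).
have Xx : X x.
  apply: (closed_cvg X X_cl _ _ xF); apply: (@filterE _ F) => k.
  by have [] := iterate_feasible k.
have Yy : calY Y y.
  move=> j; have /cvg_submxcol /(_ j) yjF := yF.
  apply: (closed_cvg (@Y j) (Y_cl j) _ _ yjF); apply: (@filterE _ F) => k.
  by have [_] := iterate_feasible k; apply.
have res0 : res (x, y) = 0.
  apply: (norm_cvg_unique _ r0).
  apply: cvgB; last exact: cvg_cst.
  by apply: cvgD; exact: cvg_mulmx.
apply/MstarP; split=> // x' y' Xx' Yy'.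
have fF : f x <= f x' - dot l (A *m (x' - x)).
  apply: (lsc_le_cvg (a := fun k => f x' - dot ((w k).2 - beta *: half_residual k)
    (A *m (x' - (w k.+1).1.1))) f_lsc xF).
    apply: cvgB; first exact: cvg_cst.
    apply: cvg_dot => //; apply: cvg_mulmx; apply: cvgB => //; exact: cvg_cst.
  move=> k; have := x_step_vi (w_step k) Xx'.
  by rewrite -/(half_residual k) => ?; lra.
have gF j : g (submxcol y j) <= g (submxcol y' j)
    - dot (l - 0) (B j *m (submxcol y' j - submxcol y j)).
  have /cvg_submxcol /(_ j) yjF := yF.
  apply: (lsc_le_cvg (a := fun k => g (submxcol y' j) - dot ((w k).2
    - beta *: half_residual k - beta *: (tau *: half_residual k
        + (1 + sigma) *: block_step k j))
      (B j *m (submxcol y' j - submxcol (w k.+1).1.2 j))) (g_lsc j) yjF).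
    apply: cvgB; first exact: cvg_cst.
    apply: cvg_dot; last first.
      by apply: cvg_mulmx; apply: cvgB => //; exact: cvg_cst.
    have lim : l - 0 = l - beta *: (tau *: 0 + (1 + sigma) *: 0).
      by rewrite !scaler0 addr0 scaler0.
    rewrite [X in _ --> X]lim; apply: cvgB => //; apply: cvgZr.
    apply: cvgD; apply: cvgZr => //.
    exact: half_residual_cvg0.
  by move=> k; have := block_gap_step k (Yy' j); lra.
have := gap_split x' x y' y l (fun=> 0).
rewrite res0 (subr0 (res _)) [X in _ = _ + X]big1 => [|j _]; last by rewrite dot0l.
rewrite addr0 => <-.
apply: addr_ge0; first by lra.
by apply: sumr_ge0 => j _; have := gF j; lra.
Qed.

(** * Control of the errors by the merit function *)

Context (sigma_gt : q%:R - 1 < sigma) (tau_s_in_K : calK (tau, s)).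

(** The vector squared in Phi: the merit function bounds it directly, and nu only through it and
    b. *)
Definition shifted_dual_err (ws : wspace) k : 'cV[R]_n :=
  dual_err ws.2 k - tau *: \sum_j block_err ws.1.2 k j.

Lemma merit_at_ge ws k :
  (1 + sigma - q%:R) * sqsum (block_err ws.1.2 k.+1)
  + (tau + s)^-1 * dot (shifted_dual_err ws k.+1) (shifted_dual_err ws k.+1)
  <= merit_at ws k.
Proof. by have [? ? ? _] := calK_bounds tau_s_in_K; apply: merit_ge. Qed.

Let sigma_coef_gt0 : 0 < 1 + sigma - q%:R.
Proof. by move: sigma_gt; lra. Qed.

Lemma sqsum_block_err_le ws k :
  sqsum (block_err ws.1.2 k.+1) <= (1 + sigma - q%:R)^-1 * merit_at ws k.
Proof.
have [ts0 _ _ _] := calK_bounds tau_s_in_K.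
rewrite ler_pdivlMl //.
apply: le_trans (merit_at_ge ws k); rewrite lerDl.
by rewrite mulr_ge0 ?dot_ge0 // invr_ge0 ltW.
Qed.

Lemma dot_shifted_dual_le ws k :
  dot (shifted_dual_err ws k.+1) (shifted_dual_err ws k.+1)
  <= (tau + s) * merit_at ws k.
Proof.
have [ts0 _ _ _] := calK_bounds tau_s_in_K.
rewrite -ler_pdivrMl //; apply: le_trans (merit_at_ge ws k); rewrite lerDr.
by rewrite mulr_ge0 ?sqsum_ge0 // ltW.
Qed.

Lemma merit_at_ge0 ws k : 0 <= merit_at ws k.
Proof.
have : 0 <= (1 + sigma - q%:R)^-1 * merit_at ws k.
  by apply: le_trans (sqsum_block_err_le ws k); exact: sqsum_ge0.
by rewrite pmulr_rge0 // invr_gt0.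
Qed.

Lemma err_cvg0 ws : merit_at ws @ \oo --> (0 : R) ->
  (forall j, (fun k => block_err ws.1.2 k.+1 j) @ \oo --> (0 : 'cV[R]_n)) /\
  (fun k => dual_err ws.2 k.+1) @ \oo --> (0 : 'cV[R]_n).
Proof.
move=> merit0.
have b0 j : (fun k => block_err ws.1.2 k.+1 j) @ \oo --> (0 : 'cV[R]_n).
  apply: dot_cvg0; apply: (cvg0_le (C := (1 + sigma - q%:R)^-1)) merit0 => k.
    exact: dot_ge0.
  exact: le_trans (dot_le_sqsum _ j) (sqsum_block_err_le ws k).
split=> //.
rewrite (_ : (fun k => _) = fun k => shifted_dual_err ws k.+1
    + tau *: \sum_j block_err ws.1.2 k.+1 j); last first.
  by apply/funext => k; rewrite subrK.
rewrite -[X in _ --> X]addr0; apply: cvgD.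
  apply: dot_cvg0; apply: (cvg0_le (C := tau + s)) merit0 => k.
    exact: dot_ge0.
  exact: dot_shifted_dual_le.
by rewrite -[X in _ --> X](scaler0 _ tau); apply: cvgZr; exact: cvg_bigsum0.
Qed.

(** * Vanishing steps and residuals, bounded errors *)

Context (ws : wspace) (ws_saddle : Mstar f g A B c X Y ws).

Let decrement k := blockform sigma (block_step k.+1)
  + (2 - tau - s - (1 - s) ^+ 2 / (1 + tau))
    * dot (res (w k.+2).1) (res (w k.+2).1).

Let merit_step ws' k : Mstar f g A B c X Y ws' ->
  merit_at ws' k.+1 + decrement k <= merit_at ws' k.
Proof.
by move=> Mws'; exact: (merit_at_decrease k Mws' sigma_gt tau_s_in_K).
Qed.

Let residual_coef_gt0 : 0 < 2 - tau - s - (1 - s) ^+ 2 / (1 + tau).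
Proof. by have [_ _ _] := calK_bounds tau_s_in_K; rewrite -subr_gt0. Qed.

Let decrement_ge0 k : 0 <= decrement k.
Proof.
by rewrite addr_ge0 ?blockform_ge0 // mulr_ge0 ?dot_ge0 // ltW.
Qed.

Lemma merit_at_nonincreasing ws' k : Mstar f g A B c X Y ws' ->
  merit_at ws' k.+1 <= merit_at ws' k.
Proof.
by move=> /(merit_step k); have := decrement_ge0 k; lra.
Qed.

Let decrement_cvg0 : decrement @ \oo --> (0 : R).
Proof.
apply: (decrease_cvg0 (u := merit_at ws)) => // k; first exact: merit_at_ge0.
exact: merit_step.
Qed.

Lemma sqsum_block_step_cvg0 :
  (fun k => sqsum (block_step k)) @ \oo --> (0 : R).
Proof.
have : (fun k => sqsum (block_step k.+1)) @ \oo --> (0 : R).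
  apply: (cvg0_le (C := (1 + sigma - q%:R)^-1)) decrement_cvg0 => k.
    exact: sqsum_ge0.
  rewrite ler_pdivlMl //.
  apply: le_trans (blockform_ge _ _) _.
  by rewrite lerDl mulr_ge0 ?dot_ge0 // ltW.
by rewrite (cvg_shiftS (fun k => sqsum (block_step k))).
Qed.

Lemma dot_residual_cvg0 :
  (fun k => dot (res (w k).1) (res (w k).1)) @ \oo --> (0 : R).
Proof.
pose u k := dot (res (w k).1) (res (w k).1).
(* The decrement at k contains the residual of iterate k + 2, hence the two shifts below. *)
have : (fun k => u k.+2) @ \oo --> (0 : R).
  apply: (cvg0_le (C := (2 - tau - s - (1 - s) ^+ 2 / (1 + tau))^-1))
    decrement_cvg0 => k; first exact: dot_ge0.
  by rewrite ler_pdivlMl // lerDr blockform_ge0.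
by rewrite (cvg_shiftS (fun k => u k.+1)) (cvg_shiftS u).
Qed.

Lemma block_step_cvg0 j : block_step ^~ j @ \oo --> (0 : 'cV[R]_n).
Proof.
apply: dot_cvg0; apply: (cvg0_le (C := 1)) sqsum_block_step_cvg0 => k.
  exact: dot_ge0.
by rewrite mul1r dot_le_sqsum.
Qed.

Lemma residual_cvg0 : (fun k => res (w k.+1).1) @ \oo --> (0 : 'cV[R]_n).
Proof.
apply: dot_cvg0; have := dot_residual_cvg0.
by rewrite -(cvg_shiftS (fun k => dot (res (w k).1) (res (w k).1))).
Qed.

Lemma merit_at_bounded k : merit_at ws k <= merit_at ws 0.
Proof.
have /nonincreasing_seqP : forall k, merit_at ws k.+1 <= merit_at ws k.
  by move=> i; exact: merit_at_nonincreasing.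
by apply.
Qed.

Lemma err_ultra_cvg (U : set_system nat) {UU : UltraFilter U} :
  exists b : 'I_q -> 'cV[R]_n, exists nu : 'cV[R]_n,
    (forall j, (fun k => block_err ws.1.2 k.+1 j) @ U --> b j) /\
    (fun k => dual_err ws.2 k.+1) @ U --> nu.
Proof.
have [ts0 _ _ _] := calK_bounds tau_s_in_K.
have sig0 : 0 < (1 + sigma - q%:R)^-1 by rewrite invr_gt0.
have /choice[b bU] : forall j, exists bj : 'cV[R]_n,
    (fun k => block_err ws.1.2 k.+1 j) @ U --> bj.
  move=> j; apply: (ultra_bounded_cvg
    (M := (1 + sigma - q%:R)^-1 * merit_at ws 0)) => k.
  apply: le_trans (dot_le_sqsum _ j) _.
  apply: le_trans (sqsum_block_err_le ws k) _.
  by rewrite ler_pM2l // merit_at_bounded.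
have [nu nuU] : exists nu : 'cV[R]_n,
    (fun k => shifted_dual_err ws k.+1) @ U --> nu.
  apply: (ultra_bounded_cvg (M := (tau + s) * merit_at ws 0)) => k.
  apply: le_trans (dot_shifted_dual_le ws k) _.
  by rewrite ler_pM2l // merit_at_bounded.
exists b, (nu + tau *: \sum_j b j); split=> //.
have -> : (fun k => dual_err ws.2 k.+1) = fun k => shifted_dual_err ws k.+1
    + tau *: \sum_j block_err ws.1.2 k.+1 j.
  by apply/funext => k; rewrite subrK.
apply: cvgD => //; apply: cvgZr.
exact: (@cvg_bigsum _ _ _ _ U _ (fun j k => block_err ws.1.2 k.+1 j) b bU).
Qed.

End Iteration.

Theorem theorem11 (R : realType) (q m n : nat) (d : 'I_q -> nat)
  (f : 'cV[R]_m -> R) (g : forall j : 'I_q, 'cV[R]_(d j) -> R)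
  (A : 'M[R]_(n, m)) (B : forall j : 'I_q, 'M[R]_(n, d j)) (c : 'cV[R]_n)
  (X : set 'cV[R]_m) (Y : forall j : 'I_q, set 'cV[R]_(d j))
  (q_ge1 : (1 <= q)%N)
  (f_cpc : closed_proper_convex f)
  (g_cpc : forall j : 'I_q, closed_proper_convex (g j))
  (A_rank : \rank A = m)
  (B_rank : forall j : 'I_q, \rank (B j) = d j)
  (X_closed : closed X) (X_convex : @convex_set R 'cV[R]_m X)
  (Y_closed : forall j : 'I_q, closed (Y j))
  (Y_convex : forall j : 'I_q, @convex_set R 'cV[R]_(d j) (Y j))
  (sol_nonempty : solutions f g A B c X Y !=set0)
  (Mstar_nonempty : Mstar f g A B c X Y !=set0)
  (beta sigma2 tau s : R)
  (beta_gt0 : 0 < beta)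
  (sigma2_gt : q%:R - 1 < sigma2)
  (tau_s_in_K : calK (tau, s))
  (w : nat -> 'cV[R]_m * 'cV[R]_(\sum_j d j) * 'cV[R]_n)
  (w_admm : gs_admm_b f g A B c X Y beta sigma2 tau s w) :
  [/\ (fun k : nat => \sum_(j < q)
         norm2 (B j *m (submxcol (w k).1.2 j - submxcol (w k.+1).1.2 j)) ^+ 2)
        @ \oo --> (0 : R),
      (fun k : nat => norm2 (residual A B c (w k).1)) @ \oo --> (0 : R)
    & exists2 winf, Mstar f g A B c X Y winf
        & wtilde A B c beta w @ \oo --> winf].

Proof.
have [_ w_step] := w_admm.
have [ws Mws] := Mstar_nonempty.
have [f_lsc _ f_conv] := f_cpc.
have g_lsc j : lower_semicontinuous (EFin \o g j) by have [] := g_cpc j.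
have g_conv j : @convex_function R 'cV[R]_(d j) setT (g j) by have [] := g_cpc j.
have e0 := block_step_cvg0 beta_gt0 f_conv g_conv X_convex Y_convex w_step
  sigma2_gt tau_s_in_K Mws.
have r0 := residual_cvg0 beta_gt0 f_conv g_conv X_convex Y_convex w_step
  sigma2_gt tau_s_in_K Mws.
split.
- rewrite (_ : (fun k => _) = fun k => sqsum (block_step B w k)).
    exact: (sqsum_block_step_cvg0 beta_gt0 f_conv g_conv X_convex Y_convex w_step
      sigma2_gt tau_s_in_K Mws).
  apply/funext => k; apply: eq_bigr => j _.
  by rewrite norm2_sqr /block_step -opprB mulmxN dotNl dotNr opprK.
- have dotr0 := dot_residual_cvg0 beta_gt0 f_conv g_conv X_convex Y_convex w_step
    sigma2_gt tau_s_in_K Mws.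
  have := cvg_comp _ _ dotr0 (@sqrt_continuous R 0).
  by rewrite sqrtr0.
have [LA LA_inv] := full_column_rank_linv A_rank.
pose LB (j : 'I_q) := projT1 (cid (full_column_rank_linv (B_rank j))).
have LB_inv j : LB j *m B j = 1%:M.
  exact: projT2 (cid (full_column_rank_linv (B_rank j))).
(* An ultrafilter finer than the tails: it inherits every limit at infinity and gives the bounded
   errors a limit. *)
have [U [UU subU]] := ultraFilterLemma (@eventually_filter).
have toU (V : topologicalType) (u : nat -> V) (l : V) :
    u @ \oo --> l -> u @ U --> l by move=> ul P /ul; exact: subU.
have [b [nu [bU nuU]]] := @err_ultra_cvg _ _ _ _ _ _ _ _ _ _ _ _ _ _ _ _
  beta_gt0 f_conv g_conv X_convex Y_convex _ w_step sigma2_gt tau_s_in_K _ Mws U UU.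
pose yinf := ws.1.2 + \mxcol_j (LB j *m b j).
pose linf := ws.2 + beta *: nu.
pose winf := (LA *m (c - calB B *m yinf), yinf, linf).
have wU : wtilde A B c beta w @ U --> winf.
  exact: (wtilde_cvg beta_gt0 w_step LA_inv LB_inv (toU _ _ _ r0)
    (fun j => toU _ _ _ (e0 j)) bU nuU).
have Mwinf : Mstar f g A B c X Y winf.
  exact: (cluster_in_Mstar f_conv g_conv X_convex Y_convex w_step f_lsc g_lsc
    X_closed Y_closed (toU _ _ _ r0) (fun j => toU _ _ _ (e0 j)) wU).
exists winf => //.
have yU : (fun k => (w k.+1).1.2) @ U --> yinf.
  exact: (cvg_comp _ _ (cvg_comp _ _ wU cvg_fst) cvg_snd).
(* From here on the reference point is winf instead of ws. *)
have bU0 j : (fun k => block_err B w yinf k.+1 j) @ U --> (0 : 'cV[R]_n).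
  rewrite -[X in _ --> X](mulmx0 _ (B j)) -(subrr (submxcol yinf j)).
  apply: cvg_mulmx; apply: cvgB; last exact: cvg_cst.
  by move/cvg_submxcol: yU; apply.
have nuU0 : (fun k => dual_err beta w linf k.+1) @ U --> (0 : 'cV[R]_n).
  rewrite (_ : (fun k => _) = fun k => dual_err beta w ws.2 k.+1 - nu).
    by rewrite -[X in _ --> X](subrr nu); apply: cvgB => //; exact: cvg_cst.
  apply/funext => k; rewrite /dual_err; move: (w k.+1).2 => l.
  by apply/colP => i; rewrite !mxE; field; rewrite gt_eqF.
(* Since winf is itself a saddle point, its merit is monotone, and the limit 0 along U extends to
   the whole sequence. *)
have merit0 : merit_at A B c beta sigma2 tau s w winf @ \oo --> (0 : R).
  apply: (nonincreasing_cvg0 (F := U)) => [k|k|].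
  - exact: merit_at_ge0.
  - exact: (merit_at_nonincreasing beta_gt0 f_conv g_conv X_convex Y_convex w_step
      sigma2_gt tau_s_in_K).
  - exact: (@merit_cvg0 _ _ _ _ U _ _ _ _ _ _ _ _ bU0 nuU0 (toU _ _ _ r0)
      (fun j => toU _ _ _ (e0 j))).
have [b0 nu0] := err_cvg0 sigma2_gt tau_s_in_K merit0.
(* Applied at winf with zero limit errors, [wtilde_cvg] returns winf plus these zero corrections;
   its x-component agrees because winf was built by the same formula. *)
have corr0 : \mxcol_j (LB j *m (0 : 'cV[R]_n)) = 0.
  by apply/colP => i; rewrite [LHS]mxE mulmx0 !mxE.
have : wtilde A B c beta w @ \oo -->
    (LA *m (c - calB B *m (yinf + \mxcol_j (LB j *m (0 : 'cV[R]_n)))),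
     yinf + \mxcol_j (LB j *m (0 : 'cV[R]_n)), linf + beta *: (0 : 'cV[R]_n)).
  exact: (wtilde_cvg beta_gt0 w_step LA_inv LB_inv r0 e0 b0 nu0).
by rewrite corr0 scaler0 !addr0.
Qed.
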